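(* Let $N$ be a positive integer, and let $\hat{\mathbf Q},\mathbf Q\in\mathbb R^N$ be non-constant vectors. Let $l$ be the Norm-in-Norm loss with $p=2$ and $q=2$, and let $\rho(\hat{\mathbf Q},\mathbf Q)$ be Pearson's linear correlation coefficient, both as defined in the context. Then $$l(\hat{\mathbf Q},\mathbf Q)=\frac{1-\rho(\hat{\mathbf Q},\mathbf Q)}{2}.$$
   Context: Norm-in-Norm loss with parameters $p,q\ge 1$. For $\hat{\mathbf Q}=(\hat Q_1,\dots,\hat Q_N)$ and $\mathbf Q=(Q_1,\dots,Q_N)$ in $\mathbb R^N$, set $$\hat a=\frac1N\sum_{i=1}^N\hat Q_i,\quad \hat b=\Big(\sum_{i=1}^N|\hat Q_i-\hat a|^q\Big)^{1/q},\quad a=\frac1N\sum_{i=1}^N Q_i,\quad b=\Big(\sum_{i=1}^N|Q_i-a|^q\Big)^{1/q},$$ $$\hat S_i=\frac{\hat Q_i-\hat a}{\hat b},\qquad S_i=\frac{Q_i-a}{b}\qquad(i=1,\dots,N).$$ The loss is $$l(\hat{\mathbf Q},\mathbf Q)=\frac1c\sum_{i=1}^N|\hat S_i-S_i|^p,\qquad c=\begin{cases}2^pN^{1-p/q}& p<q,\\ 2^p& p\ge q.\end{cases}$$ Pearson's linear correlation coefficient is $$\rho(\hat{\mathbf Q},\mathbf Q)=\frac{\sum_{i=1}^N(\hat Q_i-\hat a)(Q_i-a)}{\sqrt{\sum_{i=1}^N(\hat Q_i-\hat a)^2\sum_{i=1}^N(Q_i-a)^2}}.$$ *)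

(* Defs.v *)
From mathcomp Require Import all_boot all_order all_algebra.
From mathcomp Require Import reals exp.

Set Implicit Arguments.
Unset Strict Implicit.
Unset Printing Implicit Defensive.

Import Order.TTheory GRing.Theory Num.Theory.

Local Open Scope ring_scope.

Definition mean (R : realType) (N : nat) (Q : 'rV[R]_N) : R :=
  N%:R^-1 * \sum_(i < N) Q 0 i.

(* The [b] of the loss (and [b-hat], when applied to [Qhat]). *)
Definition scale (R : realType) (N : nat) (q : R) (Q : 'rV[R]_N) : R :=
  (\sum_(i < N) `|Q 0 i - mean Q| `^ q) `^ q^-1.

(* The [S] of the loss (and [S-hat], when applied to [Qhat]). *)
Definition normalized (R : realType) (N : nat) (q : R) (Q : 'rV[R]_N) :
    'rV[R]_N :=
  \row_(i < N) ((Q 0 i - mean Q) / scale q Q).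

Definition loss_const (R : realType) (N : nat) (p q : R) : R :=
  if p < q then 2 `^ p * N%:R `^ (1 - p / q) else 2 `^ p.

(* The Norm-in-Norm loss, intended for p, q >= 1 and non-constant arguments
   (for a constant vector, [scale] is 0 and [normalized] is the junk value 0). *)
Definition nin_loss (R : realType) (N : nat) (p q : R) (Qhat Q : 'rV[R]_N) : R :=
  (loss_const N p q)^-1 *
  \sum_(i < N) `|normalized q Qhat 0 i - normalized q Q 0 i| `^ p.

Definition plcc (R : realType) (N : nat) (Qhat Q : 'rV[R]_N) : R :=
  (\sum_(i < N) (Qhat 0 i - mean Qhat) * (Q 0 i - mean Q)) /
  Num.sqrt ((\sum_(i < N) (Qhat 0 i - mean Qhat) ^+ 2) *
            (\sum_(i < N) (Q 0 i - mean Q) ^+ 2)).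

Definition nonconstant (R : realType) (N : nat) (Q : 'rV[R]_N) : Prop :=
  ~ exists x : R, forall i : 'I_N, Q 0 i = x.

(* Main.v *)
Require Import Defs.
From mathcomp Require Import all_boot all_order all_algebra.
From mathcomp Require Import reals exp.
From mathcomp Require Import ring.

Import Order.TTheory GRing.Theory Num.Theory.

Local Open Scope ring_scope.

(** For [q = 2] the scale is the Euclidean norm of the centred vector, so both normalized vectors
    are unit vectors ([sum_normalized2_sqr]) and their inner product is Pearson's correlation
    ([sum_normalized2M]). The squared distance of two unit vectors is twice one minus their inner
    product ([sum_sqrB_unit]); dividing by the loss constant 4 gives the claim. *)

Lemma powR_norm2 (R : realType) (x : R) : `|x| `^ 2 = x ^+ 2.
Proof. by rewrite (powR_mulrn 2 (normr_ge0 x)) real_normK ?num_real. Qed.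

Lemma normalizedE (R : realType) (N : nat) (q : R) (Q : 'rV[R]_N) (i : 'I_N) :
  normalized q Q 0 i = (Q 0 i - mean Q) / scale q Q.
Proof. exact: mxE. Qed.

Lemma scale2E (R : realType) (N : nat) (Q : 'rV[R]_N) :
  scale 2 Q = Num.sqrt (\sum_(i < N) (Q 0 i - mean Q) ^+ 2).
Proof.
rewrite /scale (eq_bigr _ (fun i _ => powR_norm2 R (Q 0 i - mean Q))).
by rewrite powR12_sqrt // sumr_ge0 // => i _; exact: sqr_ge0.
Qed.

(** A vanishing sum of squares would force every entry to equal the mean. *)
Lemma nonconstant_sumsq_gt0 (R : realType) (N : nat) (Q : 'rV[R]_N) :
  nonconstant Q -> 0 < \sum_(i < N) (Q 0 i - mean Q) ^+ 2.
Proof.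
move=> hQ; have sq_ge0 i : true -> 0 <= (Q 0 i - mean Q) ^+ 2 by rewrite sqr_ge0.
rewrite lt0r sumr_ge0 // andbT; apply/negP => /eqP sum0.
apply: hQ; exists (mean Q) => i.
by apply/eqP; rewrite -subr_eq0 -sqrf_eq0; apply/eqP/(psumr_eq0P sq_ge0 sum0).
Qed.

Lemma sum_sqrB_unit (R : comPzRingType) (I : finType) (u v : I -> R) :
  \sum_i u i ^+ 2 = 1 -> \sum_i v i ^+ 2 = 1 ->
  \sum_i (u i - v i) ^+ 2 = (1 - \sum_i u i * v i) *+ 2.
Proof.
move=> u1 v1; under eq_bigr do rewrite sqrrB.
by rewrite big_split sumrB sumrMnl /= u1 v1 mulrnBl mulr2n addrAC.
Qed.

(** Non-constancy makes the scale nonzero, so the final quotient is 1 and not the default value 0 of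
    division by zero. *)
Lemma sum_normalized2_sqr (R : realType) (N : nat) (Q : 'rV[R]_N) :
  nonconstant Q -> \sum_(i < N) normalized 2 Q 0 i ^+ 2 = 1.
Proof.
move=> /nonconstant_sumsq_gt0 ss_gt0.
under eq_bigr do rewrite normalizedE expr_div_n.
by rewrite -mulr_suml scale2E sqr_sqrtr ?ltW // divff ?gt_eqF.
Qed.

Lemma sum_normalized2M (R : realType) (N : nat) (Qhat Q : 'rV[R]_N) :
  \sum_(i < N) normalized 2 Qhat 0 i * normalized 2 Q 0 i = plcc Qhat Q.
Proof.
(* Splitting the root turns the denominator into the product of the two scales, which is then
   distributed over the terms. *)
rewrite /plcc sqrtrM; last by rewrite sumr_ge0 // => i _; exact: sqr_ge0.
rewrite -!scale2E mulr_suml; apply: eq_bigr => i _.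
rewrite -mulf_div; congr (_ * _); exact: normalizedE.
Qed.

Theorem mainTheorem3 (R : realType) (N : nat) (hN : (0 < N)%N)
  (Qhat Q : 'rV[R]_N) (hQhat : nonconstant Qhat) (hQ : nonconstant Q) :
  nin_loss 2 2 Qhat Q = (1 - plcc Qhat Q) / 2.
Proof.
(* Since [2 < 2] fails, the constant is [2 ^+ 2]. *)
rewrite /nin_loss /loss_const ltxx (powR_mulrn 2 (ler0n R 2)).
under eq_bigr do rewrite powR_norm2.
have unit_hat := sum_normalized2_sqr R N Qhat hQhat.
have unit_Q := sum_normalized2_sqr R N Q hQ.
rewrite (sum_sqrB_unit _ _ _ _ unit_hat unit_Q) sum_normalized2M.
by field.
Qed.
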